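(* Let $D,\mathrm{m},k$ be positive integers. Consider an $\mathrm{m}\times\mathrm{m}$ matrix-valued function $\mathbf{M}=\mathbf{M}(u_0,u_1,\dots,u_k,\lambda)$, where $u_\ell=(u^1_\ell,\dots,u^D_\ell)$ for each $\ell$ and $\lambda$ is a scalar complex parameter; $\mathbf{M}$ is defined, analytic and invertible on an open subset $\mathbb{W}$ of the space $\mathbb{C}^{(k+1)D+1}$ with coordinates $u^\xi_\ell$ ($\ell=0,\dots,k$, $\xi=1,\dots,D$) and $\lambda$. Suppose that for all $i,j=1,\dots,D$ $$\frac{\partial}{\partial u^i_0}\Big(\frac{\partial}{\partial u^j_k}\big(\mathbf{M}(u_0,u_1,\dots,u_k,\lambda)\big)\cdot \mathbf{M}(u_0,u_1,\dots,u_k,\lambda)^{-1}\Big)=0.$$ Then there is an $\mathrm{m}\times\mathrm{m}$ matrix gauge transformation $\mathbf{g}=\mathbf{g}(u_0,\dots,u_{k-1},\lambda)$ such that the matrix-valued function $$\hat{\mathbf{M}}=\mathbb{S}(\mathbf{g})\cdot\mathbf{M}\cdot\mathbf{g}^{-1}$$ is of the form $\hat{\mathbf{M}}=\hat{\mathbf{M}}(u_0,\dots,u_{k-1},\lambda)$. Thus, applying this gauge transformation, one eliminates the dependence on $u_k=(u^1_k,\dots,u^D_k)$.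
   Context: The vectors $u_\ell=(u^1_\ell,\dots,u^D_\ell)$, $\ell\in\mathbb{Z}$, are regarded as independent quantities (dynamical variables), with complex-valued components. Each considered function is assumed to be analytic on its domain of definition. Points where the matrix $\mathbf{M}$ is singular are excluded from consideration. The notation $h=h(u_\alpha,\dots,u_\beta,\lambda)$ means that $h$ may depend only on $u^\xi_\ell$ for $\ell=\alpha,\dots,\beta$, $\xi=1,\dots,D$, and on $\lambda$. Shift operator: $\mathbb{S}$ acts on functions of the dynamical variables by replacing each $u^\xi_\ell$ by $u^\xi_{\ell+1}$ (the parameter $\lambda$ is unchanged). Thus for $\mathbf{g}=\mathbf{g}(u_0,\dots,u_{k-1},\lambda)$ one has $\mathbb{S}(\mathbf{g})=\mathbf{g}(u_1,\dots,u_k,\lambda)$. Gauge transformation: an invertible $\mathrm{m}\times\mathrm{m}$ matrix-valued function $\mathbf{g}$ of finitely many dynamical variables and $\lambda$. It transforms $\mathbf{M}$ into $\mathbb{S}(\mathbf{g})\cdot\mathbf{M}\cdot\mathbf{g}^{-1}$. *)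

(* Defs.v *)
From HB Require Import structures.
From mathcomp Require Import all_boot all_order all_algebra complex.
From mathcomp Require Import boolp classical_sets reals topology normedtype.
From mathcomp Require Import derive.
Set Implicit Arguments.
Unset Strict Implicit.
Unset Printing Implicit Defensive.
Import Order.TTheory GRing.Theory Num.Theory.
Import numFieldNormedType.Exports.
Local Open Scope classical_set_scope.
Local Open Scope ring_scope.

(* The complex numbers [R[i]] as a normed space over themselves, so that
   [differentiable], ['D_v] and [is_derive] below are taken over the complex
   field. *)
HB.instance Definition _ (R : rcfType) :=
  NormedModule.copy (complex R) ((complex R)^o).

(* A point [x] encodes [(u_0, ..., u_(n-1), lambda)]: the component [xi] of
   [u_l] is [x.1 l xi] (indices counted from 0), and [lambda] is [x.2]. *)
Notation jets R n D := ('M[R[i]]_(n, D) * R[i])%type.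

Section Jets.
Variables (R : realType) (D : nat).
Implicit Types n k m : nat.

(* [pd l xi] is the direction of the coordinate [u_l^xi]; the derivative along
   it is the complex partial derivative. *)
Definition pd n (l : 'I_n) (xi : 'I_D) : jets R n D := (delta_mx l xi, 0).

(* (u_0, ..., u_k, lambda) |-> (u_0, ..., u_(k-1), lambda) *)
Definition init_jet k (x : jets R k.+1 D) : jets R k D :=
  (row' ord_max x.1, x.2).

(* (u_0, ..., u_k, lambda) |-> (u_1, ..., u_k, lambda) *)
Definition tail_jet k (x : jets R k.+1 D) : jets R k D :=
  (row' ord0 x.1, x.2).

(* The function [g(u_1, ..., u_k, lambda)], for [g] a function of
   [u_0, ..., u_(k-1)] and [lambda]. *)
Definition shift_op k m (g : jets R k D -> 'M[R[i]]_m) :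
  jets R k.+1 D -> 'M[R[i]]_m := g \o @tail_jet k.

(* Used for open [A] only: complex differentiability at every point of an open
   set, i.e. (complex) analyticity there. Values of [f] outside [A] are
   irrelevant. *)
Definition analytic_on n m (A : set (jets R n D)) (f : jets R n D -> 'M[R[i]]_m) :=
  forall x, A x -> differentiable f x.

(* On the open set [U], the gauge transformation given by some
   [g(u_0, ..., u_(k-1), lambda)], analytic and invertible on an open set [V],
   turns [M(u_0, ..., u_k, lambda)] into a function
   [Mhat(u_0, ..., u_(k-1), lambda)]. The inclusion of [U] into the preimages
   of [V] says that [g] and [S(g)] are defined on the whole of [U]. *)
Definition gauge_eliminates k m (M : jets R k.+1 D -> 'M[R[i]]_m)
    (U : set (jets R k.+1 D)) : Prop :=
  exists (V : set (jets R k D)) (g Mhat : jets R k D -> 'M[R[i]]_m),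
    [/\ open V, analytic_on V g & forall v, V v -> g v \in unitmx] /\
    [/\ U `<=` (@init_jet k @^-1` V) `&` (@tail_jet k @^-1` V),
        analytic_on (@init_jet k @` U) Mhat &
        forall x, U x ->
          shift_op g x *m M x *m invmx (g (init_jet x)) = Mhat (init_jet x)].

End Jets.

(* Main.v *)
(* Fix a value a of u_0 and put
   g(u_0, ..., u_(k-1)) = M(a, u_0, ..., u_(k-1))^-1. The hypothesis says that
   the logarithmic derivatives of M in u_k do not depend on u_0, so M and
   M(a, u_1, ..., u_k) have the same ones, and
   S(g) M = M(a, u_1, ..., u_k)^-1 M has zero derivatives in u_k.
   Only first-order directional derivatives are used: a function with zero
   partial derivatives is constant on a ball of the sup norm, by the real mean
   value theorem along coordinate segments, hence on a connected open set.
   Near a point p with (p_0, ..., p_(k-1)) <> (p_1, ..., p_k), the point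
   (p_0, p_0, ..., p_(k-1)) may lie outside W; there g is taken as above, with
   a = p_0, near (p_1, ..., p_k) and equal to 1 near (p_0, ..., p_(k-1)). *)
Require Import Defs.
From HB Require Import structures.
From mathcomp Require Import all_boot all_order all_algebra complex.
From mathcomp Require Import boolp classical_sets functions.
From mathcomp Require Import reals topology normedtype.
From mathcomp Require Import derive landau ring.
Set Implicit Arguments.
Unset Strict Implicit.
Unset Printing Implicit Defensive.
Import Order.TTheory GRing.Theory Num.Theory.
Import numFieldNormedType.Exports.
Local Open Scope classical_set_scope.
Local Open Scope ring_scope.

(** * Directional derivatives and differentiability of matrix-valued functions *)

Section Differentiation.
Variables (K : numFieldType) (V : normedModType K).

Lemma is_deriveP (U W : normedModType K) (f : U -> W) (x v : U) (df : W) :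
  is_derive x v f df <->
  (h^-1 *: (f (h *: v + x) - f x) @[h --> 0^'] --> df).
Proof.
split=> [[fx <-]|fx]; first exact: fx.
by apply: DeriveDef; [apply/cvg_ex; exists df | exact: cvg_lim].
Qed.

(** For every [h] the difference quotients of [f \o psi] and of [f] coincide. This stands in for the
    chain rule where only directional derivatives of [f] are known. *)
Lemma is_derive_affine (U W : normedModType K) (psi : U -> V) (f : V -> W)
    (y w : U) (v : V) (df : W) :
  (forall h : K, psi (h *: w + y) = h *: v + psi y) ->
  is_derive (psi y) v f df -> is_derive y w (f \o psi) df.
Proof.
move=> psiE /is_deriveP fy; apply/is_deriveP.
by under eq_fun do rewrite /= psiE.
Qed.

(** On the line through [x], [f] is a function of one variable; there derivability amounts to
    differentiability, so the derivative is linear in the direction. *)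
Lemma is_derive0Z (f : V -> K) (x v : V) (c : K) :
  is_derive x v f 0 -> is_derive x (c *: v) f 0.
Proof.
move=> df; pose psi z := z *: v + x.
have d1 : is_derive (0 : K) (1 : K) (f \o psi) 0.
  apply: (@is_derive_affine _ _ psi f 0 1 v).
    by move=> h; rewrite /psi addr0 scale0r add0r [_%:A]mulr1.
  by rewrite /psi scale0r add0r.
have dpsi : differentiable (f \o psi) 0 by apply/derivable1_diffP; case: d1.
have : is_derive (0 : K) c (f \o psi) 0.
  apply: DeriveDef; first exact: diff_derivable.
  have -> : c = c *: (1 : K) by rewrite [_%:A]mulr1.
  rewrite deriveE // linearZ -deriveE //.
  by case: d1 => _ ->; exact: scaler0.
move=> /is_deriveP dc; apply/is_deriveP; apply: cvg_trans dc.
apply: near_eq_cvg; near=> h.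
by rewrite /= /psi addr0 scale0r add0r scalerA.
Unshelve. all: by end_near. Qed.

Lemma is_derive_coord m n (f : V -> 'M[K]_(m, n)) x v df i j :
  is_derive x v f df -> is_derive x v (fun y => f y i j) (df i j).
Proof.
move=> /is_deriveP fx; apply/is_deriveP.
have := cvg_comp _ _ fx (@coord_continuous K m n i j df).
apply: cvg_trans; apply: near_eq_cvg; near=> h => /=.
by rewrite !mxE.
Unshelve. all: by end_near. Qed.

Lemma near_eq_differentiable (W : normedModType K) (f g : V -> W) (x : V) :
  {near x, f =1 g} -> differentiable f x -> differentiable g x.
Proof.
move=> fg df; have -> : g = f + (g - f) by rewrite addrC subrK.
apply: differentiableD => //.
(* [g - f] vanishes near [x], so its expansion there has zero linear part. *)
have gf0 : (g - f) \o shift x = cst ((g - f) x) + \0 +o_0 id.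
  apply/eqaddoP => e e0.
  have : \forall y \near 0, f (y + x) = g (y + x).
    by have := fg; rewrite (near_shift 0) /= subr0.
  apply: filterS => y fgy; rewrite /= !fctE fgy (nbhs_singleton fg).
  by rewrite !subrr addr0 subrr normr0 mulr_ge0 // ltW.
apply/diff_locallyP.
have c0 : continuous (\0 : V -> W) by move=> y; exact: cvg_cst.
by rewrite (diff_unique c0 gf0).
Qed.

Lemma ball_segment (p a b e t : K) :
  0 <= t <= 1 -> ball p e a -> ball p e b -> ball p e (t * (b - a) + a).
Proof.
rewrite -!ball_normE /= => /andP[t0 t1] pa pb.
have -> : p - (t * (b - a) + a) = (1 - t) * (p - a) + t * (p - b) by ring.
apply: le_lt_trans (ler_normD _ _) _; rewrite !normrM.
rewrite (ger0_norm t0) (@ger0_norm _ (1 - t)) ?subr_ge0 //.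
have -> : e = (1 - t) * e + t * e by ring.
(* The strict inequality comes from the term with factor [t], so [t = 0] is treated apart. *)
move: t0; rewrite le_eqVlt => /predU1P[<-|t0].
  by rewrite subr0 !mul0r !addr0 !mul1r.
by rewrite ler_ltD // ?ltr_pM2l // ler_wpM2l ?subr_ge0 // ltW.
Qed.

Lemma differentiable_bigsum (W : normedModType K) (I : Type) (r : seq I)
    (P : pred I) (F : I -> V -> W) (x : V) :
  (forall i, P i -> differentiable (F i) x) ->
  differentiable (fun y => \sum_(i <- r | P i) F i y) x.
Proof.
move=> dF; rewrite -fct_sumE; elim/big_ind: _ => // *; exact: differentiableD.
Qed.

Lemma differentiable_bigprod (I : Type) (r : seq I)
    (P : pred I) (F : I -> V -> K) (x : V) :
  (forall i, P i -> differentiable (F i) x) ->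
  differentiable (fun y => \prod_(i <- r | P i) F i y) x.
Proof.
move=> dF; rewrite -fct_prodE; elim/big_ind: _ => // *; exact: differentiableM.
Qed.

Lemma differentiable_mx m n (f : V -> 'M[K]_(m, n)) x :
  (forall i j, differentiable (fun y => f y i j) x) -> differentiable f x.
Proof.
move=> df; under [f]eq_fun do rewrite [f _]matrix_sum_delta.
apply: differentiable_bigsum => i _; apply: differentiable_bigsum => j _.
exact: differentiableZl.
Qed.

Lemma differentiable_entry m n (f : V -> 'M[K]_(m, n)) x i j :
  differentiable f x -> differentiable (fun y => f y i j) x.
Proof.
move=> df.
apply: (@differentiable_comp _ _ _ _ f (fun N : 'M_(m, n) => N i j)) => //.
exact: differentiable_coord.
Qed.

Lemma differentiable_mulmx m n p (f : V -> 'M[K]_(m, n))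
    (g : V -> 'M[K]_(n, p)) x :
  differentiable f x -> differentiable g x ->
  differentiable (fun y => f y *m g y) x.
Proof.
move=> df dg; apply: differentiable_mx => i j.
under eq_fun do rewrite mxE.
apply: differentiable_bigsum => l _.
by apply: differentiableM; exact: differentiable_entry.
Qed.

Lemma differentiable_det n (f : V -> 'M[K]_n) x :
  (forall i j, differentiable (fun y => f y i j) x) ->
  differentiable (fun y => \det (f y)) x.
Proof.
move=> df; rewrite /determinant.
apply: differentiable_bigsum => s _; apply: differentiableM => //.
exact: differentiable_bigprod.
Qed.

Lemma near_unitmx n (f : V -> 'M[K]_n) x :
  differentiable f x -> f x \in unitmx -> \forall y \near x, f y \in unitmx.
Proof.
move=> df; rewrite unitmxE unitfE => det0.
have ddet : differentiable (fun y => \det (f y)) x.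
  by apply: differentiable_det => i j; exact: differentiable_entry.
have /cvgr_neq0/(_ det0) := differentiable_continuous ddet.
by apply: filterS => y dy; rewrite unitmxE unitfE.
Qed.

Lemma differentiable_invmx n (f : V -> 'M[K]_n) x :
  differentiable f x -> f x \in unitmx ->
  differentiable (fun y => invmx (f y)) x.
Proof.
(* [invmx] follows the adjugate formula at invertible matrices only, and [f y] stays invertible near
   [x]. *)
move=> df fx; apply: (@near_eq_differentiable _
    (fun y => (\det (f y))^-1 *: \adj (f y))).
  by apply: filterS (near_unitmx df fx) => y fy; rewrite /invmx fy.
apply: differentiable_mx => i j; under eq_fun do rewrite !mxE.
apply: differentiableM.
  apply: differentiableV; last by rewrite -unitfE.
  by apply: differentiable_det => i' j'; exact: differentiable_entry.
apply: differentiableM => //; apply: differentiable_det => i' j'.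
under eq_fun do rewrite !mxE; exact: differentiable_entry.
Qed.

Lemma derive_mulmx m n p (f : V -> 'M[K]_(m, n)) (g : V -> 'M[K]_(n, p)) x v :
  differentiable f x -> differentiable g x ->
  'D_v (fun y => f y *m g y) x = 'D_v f x *m g x + f x *m 'D_v g x.
Proof.
move=> df dg; apply/matrixP => i j.
have dfx := derivableP (diff_derivable (v := v) df).
have dgx := derivableP (diff_derivable (v := v) dg).
have dfg := derivableP (diff_derivable (v := v) (differentiable_mulmx df dg)).
have [_ <-] := is_derive_coord i j dfg.
under eq_fun do rewrite mxE.
rewrite -fct_sumE; have dsum := is_derive_sum (fun l =>
  is_deriveM (is_derive_coord i l dfx) (is_derive_coord l j dgx)).
have [_ ->] := dsum.
rewrite !mxE -big_split /=; apply: eq_bigr => l _.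
by rewrite addrC; congr (_ + _); exact: mulrC.
Qed.

(** With [h = g^-1 f], the Leibniz rule for [f = g h] gives [f' = g' h + g h'], while equal
    logarithmic derivatives give [f' = g' g^-1 f = g' h]. Hence [g h' = 0], so [h' = 0]. *)
Lemma is_derive_log_eq n (f g : V -> 'M[K]_n) x v :
  differentiable f x -> differentiable g x ->
  f x \in unitmx -> g x \in unitmx ->
  'D_v f x *m invmx (f x) = 'D_v g x *m invmx (g x) ->
  is_derive x v (fun y => invmx (g y) *m f y) 0.
Proof.
move=> df dg fx gx log_eq; set h := fun y => _.
have dh : differentiable h x.
  by apply: differentiable_mulmx => //; exact: differentiable_invmx.
apply: DeriveDef; first exact: diff_derivable.
have fE : 'D_v f x = 'D_v g x *m h x + g x *m 'D_v h x.
  rewrite -derive_mulmx //; apply: near_eq_derive.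
  by apply: filterS (near_unitmx dg gx) => y gy; rewrite mulKVmx.
have : 'D_v f x = 'D_v g x *m h x.
  by rewrite mulmxA -log_eq mulmxKV.
rewrite fE => /eqP; rewrite -subr_eq0 addrC addKr => /eqP gh0.
by rewrite -[LHS](mulKmx gx) gh0 mulmx0.
Qed.

End Differentiation.

(** * Constancy of functions with vanishing partial derivatives *)

Section Constancy.
Variable R : realType.
Local Notation C := (complex R).

Lemma real_complex_dnbhs0 : (h%:C)%C @[h --> (0 : R)^'] --> (0 : C)^'.
Proof.
(* A positive [e] in [C] has zero imaginary part, so [complex.Re e] is a radius for the preimage. *)
move=> A [e /= e0 eA]; move: e0; rewrite ltcE /= => /andP[/eqP ie re].
exists (complex.Re e) => // h /= h0 hn; apply: eA.
- move: h0; rewrite /= !sub0r !normrN => h0.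
  by rewrite normc_def /= expr0n /= addr0 sqrtr_sqr ltcE /= ie eqxx.
- by rewrite eq_complex /= eqxx andbT.
Qed.

(** The mean value theorem concerns real functions, hence the real part [F], whose derivative is
    zero because |Re z| <= |z|. *)
Lemma is_derive0_segment_Re (V : normedModType C) (f : V -> C) (x v : V) :
  (forall t : R, 0 <= t <= 1 -> is_derive ((t%:C)%C *: v + x) v f 0) ->
  complex.Re (f (v + x)) = complex.Re (f x).
Proof.
move=> df; pose F (t : R) : R := complex.Re (f ((t%:C)%C *: v + x)).
have dF (t : R) : 0 <= t <= 1 -> is_derive t 1 F 0.
  move=> /df /is_deriveP ft; apply/is_deriveP.
  have {}ft := cvg_comp _ _ real_complex_dnbhs0 ft.
  apply/cvgrPdist_lt => e e0.
  have eC0 : 0 < (e%:C)%C by rewrite ltcR.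
  move/cvgrPdist_lt: ft => /(_ _ eC0); apply: filterS => h /=.
  rewrite !sub0r !normrN => /(le_lt_trans (normc_ge_Re _)).
  have -> : h%:A = h by rewrite /GRing.scale /= mulr1.
  rewrite ltcR /F rmorphD /= scalerDl -addrA -fmorphV.
  set z := f _; set w := f _.
  congr (`|_| < _).
  by case: z => zr zi; case: w => wr wi /=; rewrite mul0r subr0.
have := @MVT _ F (fun=> 0) 0 1 ltr01.
case=> [t /itvP tI | | c _].
- by apply: dF; rewrite !tI.
- apply: derivable_within_continuous => t; rewrite in_itv /= => t01.
  by have [] := dF _ t01.
by rewrite mul0r => /eqP; rewrite subr_eq0 /F scale1r scale0r add0r => /eqP.
Qed.

Lemma is_derive0_segment (V : normedModType C) (f : V -> C) (x v : V) :
  (forall t : R, 0 <= t <= 1 -> is_derive ((t%:C)%C *: v + x) v f 0) ->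
  f (v + x) = f x.
Proof.
move=> df; have := is_derive0_segment_Re df.
(* As Re (i z) = - Im z, the result for real parts, applied to ['i%C *: f], yields the imaginary
   part. *)
have : forall t : R, 0 <= t <= 1 ->
    is_derive ((t%:C)%C *: v + x) v ('i%C *: f) 0.
  by move=> t /df dft; apply: is_derive_eq; rewrite scaler0.
move=> /is_derive0_segment_Re; rewrite !fctE.
case: (f _) => [a b]; case: (f _) => [c d] /=.
by rewrite !mul0r !mul1r !sub0r => /oppr_inj -> ->.
Qed.

(** The property that elimination requires of the ranges of u_0 and u_k. Only partial derivatives of
    [f] are assumed, since it is applied to an expression in derivatives of M. *)
Definition constant_of_partials0 n (X : set 'rV[C]_n) :=
  forall f : 'rV[C]_n -> C,
    (forall y i, X y -> is_derive y (delta_mx 0 i) f 0) ->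
    forall y z, X y -> X z -> f y = f z.

Lemma ball_constant_of_partials0 n (p : 'rV[C]_n) (e : C) :
  constant_of_partials0 (ball p e).
Proof.
move=> f df y z [e0 py] [_ pz].
(* A path from [y] to [z] that changes one coordinate at a time and is stationary from index [n]
   on. *)
pose w k : 'rV[C]_n := \row_j if (j < k)%N then z 0 j else y 0 j.
suff wE k : f (w k) = f y.
  by rewrite -(wE n); congr f; apply/rowP => j; rewrite mxE ltn_ord.
elim: k => [|k <-].
  by congr f; apply/rowP => j; rewrite mxE.
have [kn|nk] := ltnP k n; last first.
  congr f; apply/rowP => j; rewrite !mxE ltnS.
  by rewrite leq_eqVlt (ltn_eqF (leq_trans (ltn_ord j) nk)).
pose j0 := Ordinal kn; pose c := z 0 j0 - y 0 j0.
have -> : w k.+1 = c *: delta_mx 0 j0 + w k.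
  apply/rowP => j; rewrite !mxE eqxx /= ltnS leq_eqVlt.
  have [->|jj0] := eqVneq j j0; first by rewrite eqxx ltnn mulr1 subrK.
  by rewrite -val_eqE /= in jj0; rewrite (negPf jj0) mulr0 add0r.
apply: is_derive0_segment => t t01.
(* A sup-norm ball is a product of discs: only coordinate [j0] moves, and its disc is convex. *)
have ptw : ball p e ((t%:C)%C *: (c *: delta_mx 0 j0) + w k).
  split=> // i j; rewrite !mxE ord1 eqxx /=.
  have [->|jj0] := eqVneq j j0; last by rewrite !mulr0 add0r; case: ifP.
  rewrite mulr1 ltnn; apply: ball_segment => //.
  by rewrite !lecE /= eqxx.
exact/is_derive0Z/df.
Qed.

Lemma connected_constant_of_partials0 n (X : set 'rV[C]_n) :
  open X -> connected X -> constant_of_partials0 X.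
Proof.
move=> oX cX f df y z Xy Xz.
have loc p : X p -> \forall q \near p, f q = f p.
  move=> Xp; have /nbhs_ballP[e e0 eX] : nbhs p X by exact: open_nbhs_nbhs.
  apply/nbhs_ballP; exists e => // q pq.
  apply: (@ball_constant_of_partials0 _ p e) => //; last exact: ballxx.
  by move=> w i /eX; exact: df.
(* As [f] is locally constant, preimages of arbitrary sets are open in [X]. For [[set f y]] and its
   complement, this makes the level set open and closed in [X]. *)
have op (P : set C) : open (X `&` f @^-1` P).
  rewrite openE => p [Xp Pp]; near=> q; split.
    by near: q; exact: open_nbhs_nbhs.
  by rewrite /= (near (loc p Xp) q).
have : X `&` f @^-1` [set f y] = X.
  apply: cX; first by exists y.
  - exists (X `&` f @^-1` [set f y]); first exact: op.
    by rewrite setIA setIid.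
  - exists (~` (X `&` f @^-1` (~` [set f y]))); first exact/open_closedC/op.
    by rewrite setCI setIUr setICr set0U -preimage_setC setCK.
by move=> XE; move: Xz; rewrite -XE => -[].
Unshelve. all: by end_near. Qed.

End Constancy.

(** * Deleting and inserting a row of a jet; product domains *)

Section Gauge.
Variables (R : realType) (D : nat).
Local Notation C := (complex R).

(** [init_jet] and [tail_jet] are, by conversion, the cases [l = ord_max] and [l = ord0]. *)
Definition delete_jet k (l : 'I_k.+1) (x : jets R k.+1 D) : jets R k D :=
  (row' l x.1, x.2).

(** [unlift l i] is [None] exactly at [i = l], where [a] is used; [l = ord0] gives (a, u_0, ...,
    u_(k-1), lambda). *)
Definition insert_jet k (l : 'I_k.+1) (a : 'rV[C]_D) (v : jets R k D) :
    jets R k.+1 D :=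
  (\matrix_(i, j) oapp (fun i' => v.1 i' j) (a 0 j) (unlift l i), v.2).

Lemma insert_jetK k (l : 'I_k.+1) a : cancel (insert_jet l a) (delete_jet l).
Proof.
by case=> v c; congr pair; apply/matrixP => i j; rewrite !mxE liftK.
Qed.

Lemma delete_jetK k (l : 'I_k.+1) x :
  insert_jet l (row l x.1) (delete_jet l x) = x.
Proof.
case: x => x c; congr pair; apply/matrixP => i j; rewrite !mxE /=.
by case: unliftP => [i'|] -> /=; rewrite ?mxE.
Qed.

Lemma row_insert_jet k (l i : 'I_k.+1) a x :
  row i (insert_jet l a (delete_jet l x)).1 =
  if i == l then a else row i x.1.
Proof.
apply/rowP => j; rewrite !mxE; case: unliftP => [i'|] -> /=.
  by rewrite eq_sym (negPf (neq_lift _ _)) !mxE.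
by rewrite eqxx.
Qed.

(** Lets [is_derive_affine] turn partial derivatives in u_l into those of a function of one row
    vector. *)
Lemma insert_jetD k (l : 'I_k.+1) a v i h :
  insert_jet l (h *: delta_mx 0 i + a) v = h *: pd R l i + insert_jet l a v.
Proof.
case: v => v c; congr pair; last by rewrite /= scaler0 add0r.
apply/matrixP => i' j; rewrite !mxE /=; case: unliftP => [i''|] -> /=.
  by rewrite eq_sym (negPf (neq_lift _ _)) /= mulr0 add0r.
by rewrite !eqxx.
Qed.

Lemma insert_delete_jetD k (l l' : 'I_k.+1) a x i h : l != l' ->
  insert_jet l a (delete_jet l (h *: pd R l' i + x)) =
  h *: pd R l' i + insert_jet l a (delete_jet l x).
Proof.
case: x => x c ll'; congr pair.
apply/matrixP => i' j; rewrite !mxE /=; case: unliftP => [i''|] -> /=.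
  by rewrite !mxE.
by rewrite (negPf ll') /= mulr0 add0r.
Qed.

Lemma differentiable_jet_coord n (i : 'I_n) (j : 'I_D) (x : jets R n D) :
  differentiable (fun y : jets R n D => y.1 i j) x.
Proof.
apply: (@differentiable_comp _ _ _ _ fst (fun N : 'M[C]_(n, D) => N i j)).
  apply: linear_differentiable; by move=> y; exact: cvg_fst.
exact: differentiable_coord.
Qed.

Lemma differentiable_insert_jet k (l : 'I_k.+1) a (v : jets R k D) :
  differentiable (insert_jet l a) v.
Proof.
apply: differentiable_pair.
  apply: differentiable_mx => i j; under eq_fun do rewrite mxE.
  by case: unlift => [i'|] //=; exact: differentiable_jet_coord.
apply: linear_differentiable; by move=> y; exact: cvg_snd.
Qed.

Lemma differentiable_delete_jet k (l : 'I_k.+1) (x : jets R k.+1 D) :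
  differentiable (delete_jet l) x.
Proof.
apply: differentiable_pair.
  apply: differentiable_mx => i j; under eq_fun do rewrite !mxE.
  exact: differentiable_jet_coord.
apply: linear_differentiable; by move=> y; exact: cvg_snd.
Qed.

Lemma open_preimage_insert_jet k (l : 'I_k.+1) a (W : set (jets R k.+1 D)) :
  open W -> open (insert_jet l a @^-1` W).
Proof.
move=> oW; apply: open_comp => // v _.
exact/differentiable_continuous/differentiable_insert_jet.
Qed.

(** The common shape of sup-norm balls and of products X x ... x X x L: with the other coordinates
    fixed, u_l ranges over all of [X l]. *)
Definition jet_box k (X : 'I_k.+1 -> set 'rV[C]_D) (L : set C) :
    set (jets R k.+1 D) :=
  [set x | (forall l, X l (row l x.1)) /\ L x.2].

Lemma insert_jet_box k (X : 'I_k.+1 -> set 'rV[C]_D) (L : set C) l a x :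
  jet_box X L x -> X l a -> jet_box X L (insert_jet l a (delete_jet l x)).
Proof.
move=> [Xx Lx] Xa; split=> // i; rewrite row_insert_jet.
by case: eqVneq => [->|].
Qed.

Lemma row_delete_jet k (l : 'I_k.+1) i (x : jets R k.+1 D) :
  row i (delete_jet l x).1 = row (lift l i) x.1.
Proof. by apply/rowP => j; rewrite !mxE. Qed.

Lemma insert_jet_const_box k (X : set 'rV[C]_D) (L : set C) (l : 'I_k.+1) a v :
  (forall i, X (row i v.1)) -> L v.2 -> X a ->
  jet_box (fun=> X) L (insert_jet l a v).
Proof.
move=> Xv Lv Xa; split=> // i; rewrite -{1}[v](insert_jetK l a).
rewrite row_insert_jet; case: (unliftP l i) => [i'|] ->; last by rewrite eqxx.
by rewrite eq_sym (negPf (neq_lift _ _)) -row_delete_jet insert_jetK.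
Qed.

Lemma ball_insert_jet k (l : 'I_k.+1) a (v w : jets R k D) e :
  ball v e w -> ball (insert_jet l a v) e (insert_jet l a w).
Proof.
move=> [[e0 vw] vw2]; split=> //; split=> // i j; rewrite !mxE.
by case: unlift => [i'|] /=; [exact: vw | exact: ballxx].
Qed.

Lemma ball_delete_jet k (l : 'I_k.+1) (x y : jets R k.+1 D) e :
  ball x e y -> ball (delete_jet l x) e (delete_jet l y).
Proof.
by move=> [[e0 xy] xy2]; split=> //; split=> // i j; rewrite !mxE; exact: xy.
Qed.

Lemma ball_jetE k (x : jets R k.+1 D) e :
  ball x e = jet_box (fun l => ball (row l x.1) e) (ball x.2 e).
Proof.
apply/seteqP; split=> y.
  move=> [[e0 xy] xy2]; split=> // l; split=> // i j; rewrite !mxE; exact: xy.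
(* Positivity of [e] is part of a matrix ball; row [ord0] supplies it. *)
move=> [xy xy2]; split=> //; split; first by case: (xy ord0).
by move=> i j; have [_ /(_ 0 j)] := xy i; rewrite !mxE.
Qed.

End Gauge.

(** * Elimination of u_k on a product domain *)

Section Elimination.
Variables (R : realType) (D m k : nat).
Local Notation C := (complex R).
Variables (W : set (jets R k.+1 D)) (M : jets R k.+1 D -> 'M[C]_m).
Hypotheses (k_gt0 : (0 < k)%N) (M_analytic : analytic_on W M)
  (M_inv : forall x, W x -> M x \in unitmx).
Hypothesis HM : forall (i j : 'I_D) (x : jets R k.+1 D), W x ->
  is_derive x (pd R ord0 i)
    (fun y => 'D_(pd R ord_max j) M y *m invmx (M y)) 0.

Lemma ord0_neq_ord_max : ord0 != ord_max :> 'I_k.+1.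
Proof. by rewrite -val_eqE /= neq_ltn k_gt0. Qed.

Definition base_gauge (a : 'rV[C]_D) (v : jets R k D) : 'M[C]_m :=
  invmx (M (insert_jet ord0 a v)).

Lemma base_gauge_analytic a :
  analytic_on (insert_jet ord0 a @^-1` W) (base_gauge a).
Proof.
move=> v Wv; apply: differentiable_invmx; last exact: M_inv.
apply: (differentiable_comp (differentiable_insert_jet _ _ _)).
exact: M_analytic.
Qed.

Lemma base_gauge_unit a v :
  W (insert_jet ord0 a v) -> base_gauge a v \in unitmx.
Proof. by rewrite unitmx_inv; exact: M_inv. Qed.

Variables (X : 'I_k.+1 -> set 'rV[C]_D) (L : set C).
Let U := jet_box X L.
Hypothesis (UW : U `<=` W).

Variables (a : 'rV[C]_D) (Xa : X ord0 a) (X0 : constant_of_partials0 (X ord0)).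

(** By [HM], with u_1, ..., u_k and lambda fixed, each entry of the logarithmic derivative has zero
    partial derivatives in u_0 over [X ord0], so u_0 may be replaced by [a]. *)
Lemma log_derive_base j x : U x ->
  let x0 := insert_jet ord0 a (tail_jet x) in
  'D_(pd R ord_max j) M x *m invmx (M x) =
  'D_(pd R ord_max j) M x0 *m invmx (M x0).
Proof.
move=> Ux x0; apply/matrixP => r s.
pose psi y := insert_jet ord0 y (delete_jet ord0 x).
pose A y := 'D_(pd R ord_max j) M y *m invmx (M y).
have xE : psi (row ord0 x.1) = x by exact: delete_jetK.
have := X0 (f := fun y => A (psi y) r s).
move=> /(_ _ (row ord0 x.1) a); rewrite xE; apply=> //; last by case: Ux.
move=> y i Xy.
apply: (is_derive_affine (psi := psi) (f := fun z => A z r s)).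
  by move=> h; exact: insert_jetD.
have := is_derive_coord r s (HM i j (UW (insert_jet_box Ux Xy))).
by rewrite mxE.
Qed.

Variables (b : 'rV[C]_D) (Xb : X ord_max b)
  (Xmax : constant_of_partials0 (X ord_max)).

(** By [log_derive_base], M and M(a, u_1, ..., u_k) have equal logarithmic derivatives in u_k, so
    [is_derive_log_eq] applies; constancy over [X ord_max] then allows u_k to be set to [b]. *)
Lemma base_gauge_mulmx_indep x : U x ->
  let x' := insert_jet ord_max b (init_jet x) in
  base_gauge a (tail_jet x) *m M x = base_gauge a (tail_jet x') *m M x'.
Proof.
move=> Ux x'; apply/matrixP => r s.
pose psi y := insert_jet ord_max y (delete_jet ord_max x).
pose H y := base_gauge a (tail_jet y) *m M y.
have xE : psi (row ord_max x.1) = x by exact: delete_jetK.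
have := Xmax (f := fun y => H (psi y) r s).
move=> /(_ _ (row ord_max x.1) b); rewrite xE; apply=> //; last by case: Ux.
move=> y j Xy.
apply: (is_derive_affine (psi := psi) (f := fun z => H z r s)).
  by move=> h; exact: insert_jetD.
have Uz : U (psi y) by exact: insert_jet_box Ux Xy.
move: (psi y) Uz => z Uz {xE psi}.
pose N y := M (insert_jet ord0 a (delete_jet ord0 y)).
have Wz0 : W (insert_jet ord0 a (delete_jet ord0 z)).
  exact/UW/insert_jet_box.
suff : is_derive z (pd R ord_max j) H 0.
  by move/(is_derive_coord r s); rewrite mxE.
apply: (@is_derive_log_eq _ _ _ M N).
- exact/M_analytic/UW.
- apply: (differentiable_comp (g := M)); last exact: M_analytic.
  apply: (differentiable_comp (differentiable_delete_jet _ _)).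
  exact: differentiable_insert_jet.
- exact/M_inv/UW.
- exact: M_inv.
(* Since [k > 0], moving u_k commutes with replacing u_0, so the derivative of [N] at [z] is that of
   [M] at the point with u_0 = a. *)
have dM := derivableP (diff_derivable (v := pd R ord_max j) (M_analytic Wz0)).
have [|_ dN] := @is_derive_affine _ _ _ _
    (fun y => insert_jet ord0 a (delete_jet ord0 y)) M z (pd R ord_max j)
    _ _ _ dM.
  by move=> h; exact/insert_delete_jetD/ord0_neq_ord_max.
transitivity
    ('D_(pd R ord_max j) M (insert_jet ord0 a (delete_jet ord0 z))
       *m invmx (N z)).
  exact: log_derive_base.
by rewrite -dN.
Qed.

(** [g] is prescribed on the tails of points of [U] only, which leaves freedom elsewhere in [V]. *)
Lemma gauge_eliminates_box (V : set (jets R k D)) (g : jets R k D -> 'M[C]_m) :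
  open V -> analytic_on V g -> (forall v, V v -> g v \in unitmx) ->
  U `<=` (@init_jet _ _ k @^-1` V) `&` (@tail_jet _ _ k @^-1` V) ->
  (forall x, U x -> g (tail_jet x) = base_gauge a (tail_jet x)) ->
  gauge_eliminates M U.
Proof.
move=> V_open g_analytic g_inv UV gE.
pose x' (v : jets R k D) := insert_jet ord_max b v.
(* [Mhat] is the transformed matrix evaluated with the missing u_k set to [b]. *)
exists V, g, (fun v => g (tail_jet (x' v)) *m M (x' v) *m invmx (g v)).
have Ux' x : U x -> U (x' (init_jet x)) by move=> Ux; exact: insert_jet_box.
split; [by split | split; [exact: UV | move=> _ [x Ux <-] | move=> x Ux]].
  have dx' := differentiable_insert_jet ord_max b (init_jet x).
  have [Vi _] := UV _ Ux; have [_ Vt'] := UV _ (Ux' _ Ux).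
  apply: differentiable_mulmx; last first.
    by apply: differentiable_invmx; [exact: g_analytic | exact: g_inv].
  apply: differentiable_mulmx.
    apply: (differentiable_comp (g := g)); last exact: g_analytic.
    exact: (differentiable_comp dx' (differentiable_delete_jet ord0 _)).
  apply: (differentiable_comp (g := M)); first exact: dx'.
  exact/M_analytic/UW/Ux'.
rewrite /shift_op /comp (gE _ Ux) (gE _ (Ux' _ Ux)).
by rewrite base_gauge_mulmx_indep.
Qed.

End Elimination.

(* An open set W need not have connected slices, so there is in general no g
   valid on the whole of W; the claim is made near every point of W, and
   globally on every X x ... x X x L contained in W with X open and connected
   and L open (for instance on W itself when W has this form). *)
Theorem theorem1 (R : realType) (D m k : nat)
    (D_gt0 : (0 < D)%N) (m_gt0 : (0 < m)%N) (k_gt0 : (0 < k)%N)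
    (W : set (jets R k.+1 D)) (M : jets R k.+1 D -> 'M[R[i]]_m)
    (W_open : open W) (M_analytic : analytic_on W M)
    (M_inv : forall x, W x -> M x \in unitmx)
    (HM : forall (i j : 'I_D) (x : jets R k.+1 D), W x ->
      is_derive x (pd R ord0 i)
        (fun y => 'D_(pd R ord_max j) M y *m invmx (M y)) 0) :
  (forall p, W p ->
     exists U, [/\ open U, U p, U `<=` W & gauge_eliminates M U]) /\
  (forall (X : set 'rV[R[i]]_D) (L : set R[i]),
     open X -> connected X -> open L ->
     let U := [set x : jets R k.+1 D | (forall l, X (row l x.1)) /\ L x.2] in
     U `<=` W -> gauge_eliminates M U).
Proof.
split=> [p Wp|X L X_open X_conn L_open U UW]; last first.
  (* An empty [U] offers no base value [a], but there all conditions are vacuous. *)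
  have [[x Ux]|U0] := pselect (exists x, U x); last first.
    exists set0, (fun=> 0), (fun=> 0); split; first by split=> //; exact: open0.
    have {}U0 x : ~ U x by move=> Ux; apply: U0; exists x.
    by split=> [x /U0 //|_ [x /U0 //]|x /U0 //].
  set a := row ord0 x.1; have Xa : X a by case: Ux => Xx _; exact: Xx.
  have Xc := connected_constant_of_partials0 X_open X_conn.
  apply: (@gauge_eliminates_box _ _ _ _ W M k_gt0 M_analytic M_inv HM
    (fun=> X) L UW a Xa Xc a Xa Xc
    (insert_jet ord0 a @^-1` W) (base_gauge M a)).
  - exact: open_preimage_insert_jet.
  - exact: base_gauge_analytic.
  - by move=> v; exact: base_gauge_unit.
  (* All rows lie in the same [X], so [a] can be put in front of either u_0, ..., u_(k-1) or u_1,
     ..., u_k without leaving [U]. *)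
  - move=> y [Xy Ly]; split; apply: UW; apply: insert_jet_const_box => // l.
    + by have := Xy (lift ord_max l); rewrite -row_delete_jet.
    + by have := Xy (lift ord0 l); rewrite -row_delete_jet.
  - by [].
set a := row ord0 p.1.
have pE : insert_jet ord0 a (tail_jet p) = p by exact: delete_jetK.
(* The local claim is reduced to a suitable [g] for a ball, which is a box; the base values are u_0
   and u_k of its centre [p]. *)
have box e V g : 0 < e -> ball p e `<=` W ->
    open V -> analytic_on V g -> (forall v, V v -> g v \in unitmx) ->
    ball p e `<=` (@init_jet _ _ k @^-1` V) `&` (@tail_jet _ _ k @^-1` V) ->
    (forall x, ball p e x -> g (tail_jet x) = base_gauge M a (tail_jet x)) ->
    exists U, [/\ open U, U p, U `<=` W & gauge_eliminates M U].
  move=> e0 eW oV Vg gV eV gE; exists (ball p e).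
  split; [exact: ball_open | exact: ballxx | exact: eW |].
  move: eW eV gE; rewrite ball_jetE => eW eV gE.
  have cst l := @ball_constant_of_partials0 R D (row l p.1) e.
  apply: (gauge_eliminates_box k_gt0 M_analytic M_inv HM eW _ (cst ord0) _
    (cst ord_max) oV Vg gV eV gE); exact: ballxx.
(* When the two parts of [p] agree, inserting [a] in front of either gives [p], so near [p] one
   formula serves for both g and S(g). *)
have [ipt|ipt] := eqVneq (init_jet p) (tail_jet p).
  have /nbhs_ballP[e /= e0 eW] : nbhs p W by exact: open_nbhs_nbhs.
  apply: (box e (insert_jet ord0 a @^-1` W) (base_gauge M a) e0 eW).
  - exact: open_preimage_insert_jet.
  - exact: base_gauge_analytic.
  - by move=> v; exact: base_gauge_unit.
  - move=> y py; split; apply: eW; rewrite -pE.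
    + by rewrite -ipt; exact/ball_insert_jet/(ball_delete_jet ord_max).
    + exact/ball_insert_jet/(ball_delete_jet ord0).
  - by [].
(* Otherwise the Hausdorff property gives disjoint open sets on which [g] can be chosen
   independently. *)
have [[A B] /= [/set_mem At /set_mem Bi] [oA oB /eqP AB0]] :
    exists2 AB : set (jets R k D) * set (jets R k D),
      (tail_jet p \in AB.1 /\ init_jet p \in AB.2) &
      [/\ open AB.1, open AB.2 & AB.1 `&` AB.2 == set0].
  have := @norm_hausdorff _ (jets R k D : normedModType R[i]).
  by rewrite open_hausdorff; apply; rewrite eq_sym.
pose V := A `&` (insert_jet ord0 a @^-1` W).
have oV : open V by apply: openI => //; exact: open_preimage_insert_jet.
pose g v := if v \in A then base_gauge M a v else 1%:M.
have gA v : A v -> g v = base_gauge M a v by move=> Av; rewrite /g mem_set.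
have gB v : B v -> g v = 1%:M.
  by move=> Bv; rewrite /g memNset // => Av; rewrite -[False]/(set0 v) -AB0.
have cdel l : continuous (@delete_jet R D k l).
  by move=> x; exact/differentiable_continuous/differentiable_delete_jet.
(* On this ball tails stay in [V], where [g] is [base_gauge M a], and initial parts in [B], where
   [g] is 1. *)
have /nbhs_ballP[e /= e0 eS] : nbhs p (W `&`
    ((@delete_jet R D k ord0 @^-1` V) `&` (@delete_jet R D k ord_max @^-1` B))).
  apply: open_nbhs_nbhs; split.
    by apply: openI => //; apply: openI; apply: open_comp.
  by split=> //; split=> //; split=> //; rewrite /preimage /= pE.
apply: (box e (V `|` B) g e0).
- by move=> y /eS[].
- exact: openU.
(* Although [g] is defined by cases, it agrees near each point with one of two analytic functions,
   as [A] and [B] are open and disjoint. *)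
- move=> v [[Av Wv]|Bv].
    apply: near_eq_differentiable (base_gauge_analytic M_analytic M_inv Wv).
    have : nbhs v A by exact: open_nbhs_nbhs.
    by apply: filterS => w /gA.
  apply: (@near_eq_differentiable _ _ _ (fun=> 1%:M)) => //.
  have : nbhs v B by exact: open_nbhs_nbhs.
  by apply: filterS => w /gB.
- move=> v [[Av Wv]|Bv]; last by rewrite gB // unitmx1.
  by rewrite gA //; exact: (base_gauge_unit M_inv Wv).
- by move=> y /eS[_ [Vy By]]; split; [right | left].
- by move=> y /eS[_ [[Ay _] _]]; exact: gA.
Qed.
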